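(* Let $G$ be an $N$-function with $g=G'\in C^1(\mathbb{R}^+)$, and suppose there are constants $p^-,p^+$ with $1<p^--1\le\frac{t g'(t)}{g(t)}\le p^+-1<\infty$ for all $t>0$. Let $u,v$ be measurable functions on $\mathbb{R}^N$ with $u>0$, $v\ge0$, and let $1<q\le p^-$. Then there exists a constant $C=C(p^-,p^+,G(1))>0$ such that for all $x,y$, $$g(|u(x)-u(y)|)\frac{u(x)-u(y)}{|u(x)-u(y)|}\left[\frac{v(x)^q}{u(x)^{q-1}}-\frac{v(y)^q}{u(y)^{q-1}}\right]$$ $$\le C\max\left\{\left(\frac{G(|v(x)-v(y)|)}{G(1)}\right)^{\frac{q}{p^+}},\left(\frac{G(|v(x)-v(y)|)}{G(1)}\right)^{\frac{q}{p^-}}\right\}\times\max\left\{\left(\frac{G(|u(x)-u(y)|)}{G(1)}\right)^{\frac{p^--q}{p^+}},\left(\frac{G(|u(x)-u(y)|)}{G(1)}\right)^{\frac{p^+-q}{p^-}}\right\}.$$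
   Context: $G:\mathbb{R}^+\to\mathbb{R}^+$ is an $N$-function if it is continuous, convex, $G(t)=0\iff t=0$, $G(t)/t\to0$ as $t\to0$ and $G(t)/t\to\infty$ as $t\to\infty$. The expression $g(|t|)\,t/|t|$ is understood as $0$ when $t=0$. The notation $C=C(p^-,p^+,G(1))$ means that $C$ depends only on these quantities. *)

(* Defs.v *)
From HB Require Import structures.
From mathcomp Require Import all_boot all_order all_algebra.
From mathcomp Require Import all_classical all_reals all_analysis.

Set Implicit Arguments.
Unset Strict Implicit.
Unset Printing Implicit Defensive.

Import Order.TTheory GRing.Theory Num.Theory.
Import numFieldNormedType.Exports.

Local Open Scope classical_set_scope.
Local Open Scope ring_scope.

(* A function on R^+ = [0, +oo[ is represented by a total function R -> R of
   which only the values at nonnegative arguments are ever used. *)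

Definition N_function (R : realType) (G : R -> R) : Prop :=
  [/\ forall t : R, 0 <= t -> 0 <= G t,
      {within `[0, +oo[, continuous G} /\
        convex_function (`[0, +oo[%classic : set R^o) G,
      forall t : R, 0 <= t -> (G t = 0 <-> t = 0),
      G t / t @[t --> 0^'+] --> (0 : R)
    & G t / t @[t --> +oo] --> +oo].

(* f' is the derivative of f on [0, +oo[; at 0 it is the one-sided one. *)
Definition is_derivative_nneg (R : realType) (f f' : R -> R) : Prop :=
  (forall t : R, 0 < t -> is_derive t 1 f (f' t)) /\
  (f h - f 0) / h @[h --> 0^'+] --> f' 0.

Definition C1_nneg (R : realType) (f : R -> R) : Prop :=
  exists2 f' : R -> R,
    is_derivative_nneg f f' & {within `[0, +oo[, continuous f'}.

Definition box (R : realType) (n : nat) (a b : 'rV[R]_n) : set 'rV[R]_n :=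
  [set x : 'rV[R]_n | forall i, a 0 i < x 0 i <= b 0 i].

(* The library has no Lebesgue measure on 'rV[R]_n: measurability is
   Caratheodory's criterion for the Lebesgue outer measure, the infimum of the
   total volumes of countable covers by boxes. (For n = 0 this outer measure
   is constantly +oo and every set is measurable, as it should be.) *)
Definition lebesgue_outer_measure (R : realType) (n : nat)
    (A : set 'rV[R]_n) : \bar R :=
  ereal_inf [set s | exists a b : nat -> 'rV[R]_n,
    [/\ forall k i, a k 0 i <= b k 0 i,
        A `<=` \bigcup_k box (a k) (b k)
      & s = (\sum_(0 <= k <oo) (\prod_(i < n) (b k 0 i - a k 0 i))%:E)%E]].

Definition lebesgue_measurable (R : realType) (n : nat) : set (set 'rV[R]_n) :=
  (@lebesgue_outer_measure R n).-caratheodory.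

Definition lebesgue_measurable_fun (R : realType) (n : nat)
    (f : 'rV[R]_n -> R) : Prop :=
  forall Y : set R, measurable Y -> lebesgue_measurable (f @^-1` Y).

(* Main.v *)
(** Since (t, a) |-> t^q / a^(q-1) is subadditive (it is the perspective of the
    convex function t^q), for a = u(x) > b = u(y) one gets the discrete Picone
    inequality
      v(x)^q / a^(q-1) - v(y)^q / b^(q-1) <= |v(x) - v(y)|^q / (a - b)^(q-1).
    Cauchy's mean value theorem turns the bounds on t g'(t) / g(t) into
    pm <= t g(t) / G(t) <= pp, and a second application, to ln G and ln, into
    G(t) / G(1) = t^k with an exponent k = k(t) in [pm, pp].  Hence with
    d = a - b one has g(d) / d^(q-1) <= pp G(1) d^(k-q), and both d^(k-q) and
    |v(x) - v(y)|^q are powers of the quotients G(.) / G(1) whose exponents lie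
    between the two in the corresponding maximum.  So C = pp G(1) works. *)

Require Import Defs.
From HB Require Import structures.
From mathcomp Require Import all_boot all_order all_algebra.
From mathcomp Require Import all_classical all_reals all_analysis.
From mathcomp Require Import ring.

Set Implicit Arguments.
Unset Strict Implicit.
Unset Printing Implicit Defensive.

Import Order.TTheory GRing.Theory Num.Theory.
Import numFieldNormedType.Exports.

Local Open Scope classical_set_scope.
Local Open Scope ring_scope.

(** * Power inequalities and the discrete Picone inequality *)

Lemma powR_le_max (R : realType) (x a b c : R) :
  0 < x -> a <= b -> b <= c -> x `^ b <= Num.max (x `^ a) (x `^ c).
Proof.
move=> x0 ab bc; rewrite le_max; have [x1|x1] := leP 1 x.
  by rewrite (ler_powR x1 bc) orbT.
by rewrite ger_powR// x0 ltW.
Qed.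

Lemma powR_perspective (R : realType) (x y q : R) : 0 <= x -> 0 < y ->
  y * (x / y) `^ q = x `^ q / y `^ (q - 1).
Proof.
move=> x0 y0; have y1 := ltW y0.
rewrite powRB ?(gt_eqF y0) ?implybT// powRr1// invf_div powRM ?invr_ge0//.
by rewrite -(powR_inv1 y1) -powRrM mulN1r powRN mulrCA.
Qed.

(** Convexity of t^q at the points s/a and t/b, with weights a/(a+b) and b/(a+b), multiplied through
    by a+b. *)
Lemma powR_div_subadditive (R : realType) (s t a b q : R) :
  0 <= s -> 0 <= t -> 0 < a -> 0 < b -> 1 <= q ->
  (s + t) `^ q / (a + b) `^ (q - 1) <=
    s `^ q / a `^ (q - 1) + t `^ q / b `^ (q - 1).
Proof.
move=> s0 t0 a0 b0 q1; have ab0 : 0 < a + b by rewrite addr_gt0.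
rewrite -!powR_perspective ?addr_ge0//.
have l01 : 0 <= a / (a + b) <= 1.
  by rewrite divr_ge0 ?(ltW a0) ?(ltW ab0)//= ler_pdivrMr// mul1r lerDl ltW.
have [l0 l1] := andP l01.
have := @convex_powR R q q1 (Itv01 l0 l1) (s / a) (t / b).
rewrite !inE /= !in_itv /= !andbT.
move=> /(_ (divr_ge0 s0 (ltW a0)) (divr_ge0 t0 (ltW b0))).
rewrite convRE [X in X `^ _ <= _]convRE /= /unstable.onem.
have -> : a / (a + b) * (s / a) + (1 - a / (a + b)) * (t / b)
    = (s + t) / (a + b).
  by field; rewrite !gt_eqF.
move=> /(ler_wpM2l (ltW ab0)) h; apply: (le_trans h).
rewrite le_eqVlt; apply/predU1P; left; field; exact: lt0r_neq0.
Qed.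

(** If t < s, subadditivity applies to s = t + (s - t) and a = b + (a - b). If s <= t, the left side
    is nonpositive, since s^q <= t^q and b^(q-1) <= a^(q-1). *)
Lemma discrete_picone (R : realType) (a b s t q : R) :
  0 < b -> b < a -> 0 <= s -> 0 <= t -> 1 < q ->
  s `^ q / a `^ (q - 1) - t `^ q / b `^ (q - 1) <=
    `|s - t| `^ q / (a - b) `^ (q - 1).
Proof.
move=> b0 ba s0 t0 q1; have q0 : 0 < q by rewrite (lt_trans _ q1).
have a0 : 0 < a by exact: lt_trans ba.
have [st|ts] := leP s t; last first.
  rewrite gtr0_norm ?subr_gt0// lerBlDl.
  have := @powR_div_subadditive R t (s - t) b (a - b) q.
  rewrite !subrKC; apply => //; last exact: ltW.
  - by rewrite subr_ge0 ltW.
  - by rewrite subr_gt0.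
apply: (@le_trans _ _ 0); last by rewrite divr_ge0 ?powR_ge0.
rewrite subr_le0 ler_pM ?powR_ge0 ?invr_ge0 ?powR_ge0//.
  by apply: ge0_ler_powR; rewrite ?nnegrE// ltW.
rewrite lef_pV2 ?posrE ?powR_gt0//.
by apply: ge0_ler_powR; rewrite ?nnegrE ?subr_ge0 ltW.
Qed.

(** * Continuity up to the endpoint 0 *)

Lemma is_derivative_nneg_continuous (R : realType) (f f' : R -> R) (b : R) :
  0 < b -> is_derivative_nneg f f' -> {within `[0, b], continuous f}.
Proof.
move=> b0 [df df0].
have cf x : 0 < x -> {for x, continuous f}.
  move=> x0; apply/differentiable_continuous/derivable1_diffP.
  exact: (@ex_derive _ _ _ _ _ _ _ (df x x0)).
apply/(continuous_within_itvP _ b0); split.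
- by move=> x; rewrite in_itv/= => /andP[x0 _]; exact: cf.
- have id0 : h @[h --> (0:R)^'+] --> (0:R).
    by apply: cvg_at_right_filter; exact: cvg_id.
  (* For h > 0 this expression equals [f h]; its limit is f(0) + 0 * f'(0). *)
  have cf0 : f 0 + h * ((f h - f 0) / h) @[h --> 0^'+] --> f 0.
    rewrite -[X in _ --> X]addr0 -[X in _ --> _ + X](mul0r (f' 0)).
    by apply: cvgD; [exact: cvg_cst|exact: cvgM].
  apply: cvg_trans cf0; apply: near_eq_cvg; near=> h.
  have h0 : 0 < h by near: h; exact: nbhs_right_gt.
  by rewrite /= mulrC divfK ?gt_eqF// subrKC.
- by apply: cvg_at_left_filter; exact: cf.
Unshelve. all: by end_near. Qed.

(** * Growth of [G] and [g] under the elasticity bounds *)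

Section growth.
Context {R : realType} (G g : R -> R) (pm pp : R).
Hypothesis G_ge0 : forall t : R, 0 <= t -> 0 <= G t.
Hypothesis G_eq0 : forall t : R, 0 <= t -> (G t = 0 <-> t = 0).
Hypothesis dG : is_derivative_nneg G g.
Hypothesis dg : exists g', is_derivative_nneg g g'.
Hypothesis pm1 : 1 < pm.
Hypothesis g_elasticity : forall t : R, 0 < t ->
  pm - 1 <= t * derive1 g t / g t /\ t * derive1 g t / g t <= pp - 1.

Let G0 : G 0 = 0. Proof. exact/G_eq0. Qed.

Lemma G_gt0 (t : R) : 0 < t -> 0 < G t.
Proof.
move=> t0; rewrite lt0r G_ge0 ?(ltW t0)// andbT.
by apply/eqP => /(G_eq0 (ltW t0)) t_eq0; rewrite t_eq0 ltxx in t0.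
Qed.

Lemma g_neq0 (t : R) : 0 < t -> g t != 0.
Proof.
move=> t0; apply/eqP => gt; have [+ _] := g_elasticity t0.
(* Division by zero gives 0, so a zero of [g] would force pm - 1 <= 0. *)
by rewrite gt invr0 mulr0 leNgt subr_gt0 pm1.
Qed.

(* A negative value of [g] would, by continuity, produce a zero of [g] between
   it and a mean value point of [G], contradicting [g_neq0]. *)
Lemma g_gt0 (t : R) : 0 < t -> 0 < g t.
Proof.
move=> t0; rewrite ltNge; apply/negP => gt0.
have [c /[!in_itv]/= /andP[c0 ct]] : exists2 c, c \in `]0, t[%R &
    G t - G 0 = g c * (t - 0).
  apply: MVT => //; last exact: is_derivative_nneg_continuous dG.
  by move=> x; rewrite in_itv/= => /andP[x0 _]; exact: dG.1.
rewrite G0 !subr0 => Gt.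
have gc : 0 < g c by rewrite -(pmulr_lgt0 _ t0) -Gt G_gt0.
have [g' dg'] := dg.
have cg : {within `[c, t], continuous g}.
  apply: continuous_subspaceW (is_derivative_nneg_continuous t0 dg').
  by apply: subset_itvr; rewrite bnd_simp ltW.
have [||z] := @IVT R g c t 0 _ cg; first exact: ltW.
  by rewrite ge_min gt0 orbT/= le_max (ltW gc).
rewrite in_itv/= => /andP[cz _] gz.
by have := g_neq0 (lt_le_trans c0 cz); rewrite gz eqxx.
Qed.

(** Both x g(x) and G(x) vanish at 0, so Cauchy's theorem on [0, t] gives t g(t) / G(t) = c g'(c) /
    g(c) + 1 for some c in ]0, t[. *)
Lemma G_elasticity (t : R) : 0 < t -> pm <= t * g t / G t <= pp.
Proof.
move=> t0; have [g' dg'] := dg.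
have cg := is_derivative_nneg_continuous t0 dg'.
have [||||c] := @cauchy_MVT R (fun x => x * g x)
    (fun x => x * derive1 g x + g x) G g 0 t t0 _
    (is_derivative_nneg_continuous t0 dG).
- move=> x; apply: continuousM; last exact: cg.
  by apply: continuous_subspaceT => y; exact: cvg_id.
- move=> x; rewrite in_itv/= => /andP[x0 _].
  have dgx := dg'.1 x x0; apply: is_derive_eq.
  by rewrite derive1E (@derive_val _ _ _ _ _ _ _ dgx) /GRing.scale/= mulr1.
- by move=> x; rewrite in_itv/= => /andP[x0 _]; exact: dG.1.
- by move=> x; rewrite in_itv/= => /andP[x0 _]; exact: g_neq0.
rewrite in_itv/= => /andP[c0 _]; rewrite G0 mul0r !subr0 => <-.
rewrite mulrDl divff ?g_neq0//; have [+ +] := g_elasticity c0.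
by rewrite lerBlDr lerBrDr => -> ->.
Qed.

Let dlnG (x : R) : 0 < x -> is_derive x 1 (@ln R \o G) (g x / G x).
Proof.
move=> x0; have dGx := dG.1 x x0; have dlnx := is_derive1_ln (G_gt0 x0).
by apply: is_derive_eq; rewrite mulrC.
Qed.

(** By Cauchy's theorem the slope is c g(c) / G(c) for some c in ]a, b[, which [G_elasticity]
    bounds. *)
Lemma ln_G_slope (a b : R) : 0 < a -> a < b ->
  pm <= (ln (G b) - ln (G a)) / (ln b - ln a) <= pp.
Proof.
move=> a0 ab.
have pos x : x \in `[a, b] -> 0 < x.
  by rewrite in_itv/= => /andP[ax _]; exact: lt_le_trans ax.
have pos' x : x \in `]a, b[ -> 0 < x by move/subset_itv_oo_cc; exact: pos.
have [|||||c] := @cauchy_MVT R (@ln R \o G) (fun x => g x / G x) (@ln R)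
   (fun x => x^-1) a b ab.
- apply: derivable_within_continuous => x /pos x0.
  exact: (@ex_derive _ _ _ _ _ _ _ (dlnG x0)).
- apply: derivable_within_continuous => x /pos x0.
  exact: (@ex_derive _ _ _ _ _ _ _ (is_derive1_ln x0)).
- by move=> x /pos'; exact: dlnG.
- by move=> x /pos'; exact: is_derive1_ln.
- by move=> x /pos' x0; rewrite invr_eq0 gt_eqF.
move=> /pos' c0 <-; rewrite invrK mulrC mulrA.
exact: G_elasticity.
Qed.

Lemma G_powR (t : R) : 0 < t -> exists2 k, pm <= k <= pp & G t / G 1 = t `^ k.
Proof.
move=> t0; have G10 : 0 < G 1 by exact: G_gt0.
have {}G_powR k : ln (G t) - ln (G 1) = k * ln t -> G t / G 1 = t `^ k.
  move=> e; rewrite /powR gt_eqF// -e expRB !lnK ?posrE ?G_gt0//.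
have [t1|t1|->] := ltgtP t 1.
(* The slope is taken on [t, 1]; as ln 1 = 0, numerator and denominator both change sign. *)
- exists ((ln (G t) - ln (G 1)) / ln t).
    have := ln_G_slope t0 t1.
    by rewrite ln1 sub0r -opprB invrN mulrNN.
  by apply: G_powR; rewrite divfK// lt_eqF// ln_lt0// t0.
- exists ((ln (G t) - ln (G 1)) / ln t).
    by have := ln_G_slope ltr01 t1; rewrite ln1 subr0.
  by apply: G_powR; rewrite divfK// gt_eqF// ln_gt0.
(* At t = 1 every exponent fits; pm <= pp follows from [G_elasticity] at 1. *)
- exists pm; last by rewrite divff ?gt_eqF// powR1.
  have /andP[pG Gp] := G_elasticity ltr01.
  by rewrite lexx (le_trans pG Gp).
Qed.

(** With G(w) / G(1) = w^k, the exponents of w satisfy k q / pp <= q <= k q / pm. *)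
Lemma powR_le_max_G (w q : R) : 0 < w -> 0 <= q ->
  w `^ q <= Num.max ((G w / G 1) `^ (q / pp)) ((G w / G 1) `^ (q / pm)).
Proof.
move=> w0 q0; have [k /andP[pk kp] ->] := G_powR w0.
have pm0 : 0 < pm by exact: lt_trans pm1.
have pp0 : 0 < pp by rewrite (lt_le_trans pm0)// (le_trans pk).
rewrite -!powRrM; apply: powR_le_max => //.
  by rewrite mulrCA ler_piMr// ler_pdivrMr// mul1r.
by rewrite mulrCA ler_peMr// ler_pdivlMr// mul1r.
Qed.

Lemma g_div_powR_le (d q : R) : 0 < d -> 0 < q -> q <= pm ->
  g d / d `^ (q - 1) <= pp * G 1 *
    Num.max ((G d / G 1) `^ ((pm - q) / pp)) ((G d / G 1) `^ ((pp - q) / pm)).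
Proof.
move=> d0 q0 qp; have [k /andP[pk kp] Gd] := G_powR d0.
have pm0 : 0 < pm by exact: lt_trans pm1.
have pp0 : 0 < pp by rewrite (lt_le_trans pm0)// (le_trans pk).
have G10 : 0 < G 1 by exact: G_gt0.
(* Divide d g(d) <= pp G(d) = pp G(1) d^k by d^q = d * d^(q-1). *)
have gd : g d / d `^ (q - 1) <= pp * G 1 * d `^ (k - q).
  have /andP[_] := G_elasticity d0; rewrite ler_pdivrMr ?G_gt0//.
  rewrite powRB ?(gt_eqF d0) ?implybT// -Gd -(mulr_powRB1 (ltW d0) q0) => dgd.
  have e0 := powR_gt0 (q - 1) d0.
  rewrite -(mulrA pp) (mulrA (G 1)) (mulrCA (G 1)) divff ?gt_eqF// mulr1.
  by rewrite invfM mulrA mulrA ler_pM2r ?invr_gt0// ler_pdivlMr// mulrC.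
apply: (le_trans gd); rewrite ler_pM2l ?mulr_gt0// Gd -!powRrM.
(* The exponents are ordered through k (pm - q) / pp <= pm - q <= k - q <= pp - q <= k (pp - q) /
   pm. *)
apply: powR_le_max => //.
  apply: (@le_trans _ _ (pm - q)); last by rewrite lerD2r.
  by rewrite mulrCA ler_piMr ?subr_ge0// ler_pdivrMr// mul1r.
apply: (@le_trans _ _ (pp - q)); first by rewrite lerD2r.
rewrite mulrCA ler_peMr ?subr_ge0 ?ler_pdivlMr ?mul1r//.
by rewrite (le_trans qp)// (le_trans pk).
Qed.

Lemma picone_G (a b s t q : R) :
  0 < b -> b < a -> 0 <= s -> 0 <= t -> 1 < q -> q <= pm ->
  g (a - b) * (s `^ q / a `^ (q - 1) - t `^ q / b `^ (q - 1)) <=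
    pp * G 1 *
    Num.max ((G `|s - t| / G 1) `^ (q / pp)) ((G `|s - t| / G 1) `^ (q / pm)) *
    Num.max ((G (a - b) / G 1) `^ ((pm - q) / pp))
            ((G (a - b) / G 1) `^ ((pp - q) / pm)).
Proof.
move=> b0 ba s0 t0 q1 qp; have d0 : 0 < a - b by rewrite subr_gt0.
have q0 : 0 < q by exact: lt_trans q1.
have G10 : 0 < G 1 by exact: G_gt0.
have pp0 : 0 < pp.
  have /andP[pk kp] := G_elasticity d0.
  by rewrite (lt_le_trans q0)// (le_trans qp)// (le_trans pk).
have pic := discrete_picone b0 ba s0 t0 q1.
apply: (le_trans (ler_wpM2l (ltW (g_gt0 d0)) pic)).
(* The case s = t is separate because [powR_le_max_G] needs a positive base; there the Picone bound
   is 0. *)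
have [w_eq0|w_neq0] := eqVneq (s - t) 0.
  rewrite w_eq0 normr0 powR0 ?gt_eqF// mul0r mulr0.
  by rewrite !mulr_ge0 ?le_max ?powR_ge0// ltW.
rewrite mulrCA [leRHS]mulrAC [leRHS]mulrC.
rewrite ler_pM ?powR_ge0 ?divr_ge0 ?powR_ge0 ?(ltW (g_gt0 d0))//.
  by apply: powR_le_max_G; rewrite ?normr_gt0// ltW.
exact: g_div_powR_le.
Qed.

End growth.

Theorem proposition2p6 (R : realType) :
  exists C : R -> R -> R -> R,
  forall (G g : R -> R) (pm pp : R) (N : nat) (u v : 'rV[R]_N -> R) (q : R),
    N_function G ->
    is_derivative_nneg G g ->
    C1_nneg g ->
    1 < pm - 1 ->
    (forall t : R, 0 < t ->
      pm - 1 <= t * derive1 g t / g t /\ t * derive1 g t / g t <= pp - 1) ->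
    lebesgue_measurable_fun u ->
    lebesgue_measurable_fun v ->
    (forall x, 0 < u x) ->
    (forall x, 0 <= v x) ->
    1 < q -> q <= pm ->
    0 < C pm pp (G 1) /\
    forall x y : 'rV[R]_N,
      g `|u x - u y| * ((u x - u y) / `|u x - u y|) *
        (v x `^ q / u x `^ (q - 1) - v y `^ q / u y `^ (q - 1))
      <= C pm pp (G 1) *
         Num.max ((G `|v x - v y| / G 1) `^ (q / pp))
                 ((G `|v x - v y| / G 1) `^ (q / pm)) *
         Num.max ((G `|u x - u y| / G 1) `^ ((pm - q) / pp))
                 ((G `|u x - u y| / G 1) `^ ((pp - q) / pm)).
Proof.
exists (fun _ pp G1 => pp * G1).
move=> G g pm pp N u v q [G_ge0 _ G_eq0 _ _] dG [g' dg' _] pm1 ell _ _ u0 v0.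
move=> q1 qp; have {}pm1 : 1 < pm by rewrite (lt_trans pm1)// gtrBl.
have dg : exists g', is_derivative_nneg g g' by exists g'.
have G10 : 0 < G 1 by exact: G_gt0.
have pp0 : 0 < pp.
  have /andP[pk kp] := G_elasticity G_eq0 dG dg pm1 ell ltr01.
  by rewrite (lt_trans ltr01)// (lt_le_trans pm1)// (le_trans pk).
split; first exact: mulr_gt0.
move=> x y.
have key := picone_G G_ge0 G_eq0 dG dg pm1 ell.
(* Swapping x and y flips the sign of both factors on the left, so the first case reduces to the
   second; for equal values the sign quotient is 0. *)
have [uxy|uyx|->] := ltgtP (u x) (u y).
- rewrite distrC (distrC (v x)) gtr0_norm ?subr_gt0//.
  rewrite -(opprB (u y)) mulNr divff ?subr_eq0 ?gt_eqF// mulrN1 mulNr -mulrN.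
  by rewrite opprB; exact: key.
- rewrite gtr0_norm ?subr_gt0// divff ?subr_eq0 ?gt_eqF// mulr1.
  exact: key.
- rewrite subrr mul0r mulr0 mul0r.
  by rewrite !mulr_ge0 ?le_max ?powR_ge0// ltW.
Qed.
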